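(* Let $k\ge 2$ and let $n_1\ge n_2\ge\cdots\ge n_k\ge 2$ be integers. 1) If $n_1\ge k$ and $d\ge 2$, then a generic polynomial of degree $d$ on $\mathbb{C}^{n_1}\times\cdots\times\mathbb{C}^{n_k}$ is non-Cartesian. 2) If $d$ is large enough (it is sufficient that $d\ge\max\{2k-3,7\}$), then a generic polynomial of degree $d$ on $\mathbb{C}^{n_1}\times\cdots\times\mathbb{C}^{n_k}$ is non-Cartesian.
   Context: For $j=1,\dots,k$ let $x_j=(x_{j,1},\dots,x_{j,n_j})$ denote the coordinates on $\mathbb{C}^{n_j}$. A polynomial $F\in\mathbb{C}[x_1,\dots,x_k]$ is called Cartesian with respect to the product decomposition $\mathbb{C}^{n_1}\times\cdots\times\mathbb{C}^{n_k}$ if there exist non-constant polynomials $G_j\in\mathbb{C}[x_j]$ ($j=1,\dots,k$; $G_j$ depends only on the variables of the $j$-th factor) and arbitrary polynomials $H_j\in\mathbb{C}[x_1,\dots,x_k]$ such that $F=\sum_{j=1}^k G_j(x_j)H_j(x_1,\dots,x_k)$. Otherwise $F$ is non-Cartesian. ''A generic polynomial of degree $d$ has property $\mathcal{P}$'' means that there is a nonempty Zariski open subset of the finite-dimensional complex vector space of polynomials of degree at most $d$ in $\mathbb{C}[x_1,\dots,x_k]$, all of whose elements have property $\mathcal{P}$. *)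

(* Defs.v *)
From HB Require Import structures.
From mathcomp Require Import all_boot all_order all_algebra.
From mathcomp Require Import reals.
From mathcomp Require Export complex.
From mathcomp Require Export mpoly.

Set Implicit Arguments.
Unset Strict Implicit.
Unset Printing Implicit Defensive.

Import GRing.Theory.
Local Open Scope ring_scope.

(* The coordinate ring of K^(n_0) x ... x K^(n_(k-1)) is the polynomial ring  *)
(* in \sum_j n j variables; the coordinate x_(j, i) is the variable of index  *)
(* tagnat.Rank j i, where tagnat.Rank is the library's bijection between      *)
(* pairs (j, i), with j : 'I_k and i : 'I_(n j), and 'I_(\sum_j n j).         *)

(* The inclusion K[x_j] -> K[x_1, ..., x_k]. *)
Definition embed_factor (K : fieldType) (k : nat) (n : 'I_k -> nat) (j : 'I_k)
    (G : {mpoly K[n j]}) : {mpoly K[\sum_(l < k) n l]} :=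
  G \mPo [tuple 'X_(tagnat.Rank j i) | i < n j].

Definition cartesian (K : fieldType) (k : nat) (n : 'I_k -> nat)
    (F : {mpoly K[\sum_(l < k) n l]}) : Prop :=
  exists (G : forall j : 'I_k, {mpoly K[n j]})
         (H : 'I_k -> {mpoly K[\sum_(l < k) n l]}),
    (forall (j : 'I_k) (c : K), G j <> c%:MP) /\
    F = \sum_(j < k) embed_factor (G j) * H j.

(* The linear coordinates on the space of polynomials of degree at most d. *)
Definition coefs (K : fieldType) (N d : nat) (F : {mpoly K[N]}) :
    'I_#|{: 'X_{1..N < d.+1}}| -> K :=
  fun i => F@_(enum_val i).
Arguments coefs {K N} d F i.

(* U is a Zariski open subset of the space of polynomials of degree at most d *)
(* (msize F is the degree of F plus one): the complement, in that space, of   *)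
(* the common zero locus of a set S of polynomials in the coefficients.       *)
Definition zariski_open (K : fieldType) (N d : nat)
    (U : {mpoly K[N]} -> Prop) : Prop :=
  exists S : {mpoly K[#|{: 'X_{1..N < d.+1}}|]} -> Prop,
    forall F : {mpoly K[N]},
      U F <->
      (msize F <= d.+1)%N /\ exists2 P, S P & P.@[coefs d F] <> 0.

Definition generic (K : fieldType) (N d : nat)
    (Pr : {mpoly K[N]} -> Prop) : Prop :=
  exists U : {mpoly K[N]} -> Prop,
    [/\ zariski_open d U, exists F, U F & forall F, U F -> Pr F].

(* Main.v *)
Require Import Defs.
From mathcomp Require Import all_boot all_order all_algebra.
From mathcomp Require Import reals ring zify.

(* If F is Cartesian, it vanishes on a product of k hypersurfaces. Choosing   *)
(* on each hypersurface its intersections with a few given lines costs one    *)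
(* parameter per point, whereas the products of these points impose more      *)
(* independent conditions on F than there are parameters as soon as F has     *)
(* degree at least 2. So the coefficients of F satisfy a nontrivial           *)
(* polynomial relation P, which depends only on the lines. A hypersurface may *)
(* miss a given line; it meets almost all lines of a suitable pencil, and P,  *)
(* being polynomial, vanishes at F because it does so at almost all members   *)
(* of a one-parameter family of sheared copies of F.                          *)

Set Implicit Arguments.
Unset Strict Implicit.
Unset Printing Implicit Defensive.

Import Order.TTheory GRing.Theory Num.Theory.

Local Open Scope ring_scope.

(** A Cartesian [F] vanishes wherever every factor [j] lies on [G j = 0]. In each factor, take the
    lines on which coordinate 1 is 0, 1 or 2 and all later coordinates are 0. Coordinate 0 of a
    point of [G j = 0] on such a line is one parameter. When independent conditions on [F] outnumber
    the parameters, [elimination], resting on [algebraic_dependence], gives a nonzero relation [P]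
    on the coefficients. [generic_non_cartesian] uses [zero_on_lines] to treat hypersurfaces that
    miss these lines.

    For [k >= 3], two lines per factor give [2 k + 1] conditions against [2 k] parameters. For
    [k = 2] they give only 4 against 4, so a third line is added in the first factor: 6 against 5,
    or 5 against 4 if its three points are collinear. *)

(** * Points where a nonzero polynomial does not vanish *)

Lemma poly_non_root (K : numFieldType) (p : {poly K}) :
  p != 0 -> exists z, p.[z] != 0.
Proof.
move=> p0; pose s := [seq i%:R : K | i <- iota 0 (size p)].
have us : uniq s.
  by rewrite map_inj_uniq ?iota_uniq // => i j /eqP; rewrite eqr_nat => /eqP.
case: (boolP (all (root p) s)) => [rs|/allPn[z _ zr]]; last by exists z.
by have := max_poly_roots p0 rs us; rewrite size_map size_iota ltnn.
Qed.

Lemma digits_inj (B n : nat) (f g : 'I_n -> nat) :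
  (forall i, f i < B)%N -> (forall i, g i < B)%N ->
  (\sum_(i < n) f i * B ^ i = \sum_(i < n) g i * B ^ i)%N -> f =1 g.
Proof.
elim: n f g => [|n IH] f g fB gB; first by move=> _ [].
rewrite !big_ord_recl !expn0 !muln1.
have tailE (h : 'I_n.+1 -> nat) :
    (\sum_(i < n) h (lift ord0 i) * B ^ lift ord0 i =
     (\sum_(i < n) h (lift ord0 i) * B ^ i) * B)%N.
  by rewrite big_distrl; apply: eq_bigr => i _; rewrite lift0 expnSr mulnA.
rewrite !tailE => E.
have B0 : (0 < B)%N by apply: leq_ltn_trans (fB ord0).
have E0 : f ord0 = g ord0.
  by have /(congr1 (modn^~ B)) := E; rewrite !(addnC (_ ord0)) !modnMDl !modn_small.
have /(IH _ _ (fun i => fB _) (fun i => gB _)) E1 :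
    (\sum_(i < n) f (lift ord0 i) * B ^ i =
     \sum_(i < n) g (lift ord0 i) * B ^ i)%N.
  by apply/eqP; rewrite -(eqn_pmul2r B0); move: E; rewrite E0 => /addnI ->.
by move=> i; case: (unliftP ord0 i) => [j|] ->; rewrite ?E0 ?E1.
Qed.

(* Kronecker substitution [x_i := z ^+ (B ^ i)], with [B] above all exponents. *)
Lemma mpoly_non_root (K : numFieldType) (n : nat) (p : {mpoly K[n]}) :
  p != 0 -> exists v, p.@[v] != 0.
Proof.
move=> p0; pose B := msize p.
pose w (m : 'X_{1..n}) := (\sum_(i < n) m i * B ^ i)%N.
pose q := \sum_(m <- msupp p) p@_m *: 'X^(w m).
have lt_B m i : m \in msupp p -> (m i < B)%N.
  move=> mp; apply: leq_ltn_trans (msize_mdeg_lt mp).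
  by rewrite mdegE (bigD1 i) //= leq_addr.
have [m0 m0p] : exists m0, m0 \in msupp p.
  by exists (mlead p); apply: mlead_supp.
have q0 : q != 0.
  apply: contraTneq (m0p) => q0; rewrite mcoeff_msupp negbK; apply/eqP.
  have <- : q`_(w m0) = p@_m0; last by rewrite q0 coef0.
  rewrite coef_sum (bigD1_seq m0) //= coefZ coefXn eqxx mulr1 big_seq_cond.
  rewrite big1 ?addr0 // => m /andP[mp mm0]; rewrite coefZ coefXn.
  case: eqP => [E|_]; last by rewrite mulr0.
  case/eqP: mm0; apply/mnmP; apply: (@digits_inj B); last by rewrite -/(w m) -E.
    by move=> i; apply: lt_B.
  by move=> i; apply: lt_B.
have [z qz] := poly_non_root q0; exists (fun i => z ^+ (B ^ i)).
rewrite mevalE; move: qz; rewrite horner_sum; congr (_ != 0).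
apply: eq_bigr => m _; rewrite hornerZ hornerXn -prodrXr; congr (_ * _).
by apply: eq_bigr => i _; rewrite -exprM mulnC.
Qed.

(** * Algebraic dependence and elimination by counting *)

Lemma msize_mul_le (K : idomainType) (n : nat) (p q : {mpoly K[n]}) (a b : nat) :
  (msize p <= a.+1)%N -> (msize q <= b.+1)%N -> (msize (p * q)%R <= (a + b).+1)%N.
Proof.
move=> pa qb; have [->|] := eqVneq (p * q) 0; first by rewrite msize0.
rewrite mulf_eq0 negb_or => /andP[p0 q0]; rewrite msizeM //.
by have := leq_add pa qb; rewrite addSn addnS; case: (_ + _)%N.
Qed.

Lemma msize_prod_le (K : idomainType) (n : nat) (I : Type) (r : seq I)
    (p : I -> {mpoly K[n]}) (d : I -> nat) :
  (forall i, msize (p i) <= (d i).+1)%N ->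
  (msize (\prod_(i <- r) p i)%R <= (\sum_(i <- r) d i).+1)%N.
Proof.
move=> pd; elim: r => [|i r IH]; first by rewrite !big_nil msize1.
by rewrite !big_cons; apply: msize_mul_le.
Qed.

Lemma msize_exp_le (K : idomainType) (n : nat) (p : {mpoly K[n]}) (d e : nat) :
  (msize p <= d.+1)%N -> (msize (p ^+ e) <= (e * d).+1)%N.
Proof.
move=> pd; have := @msize_prod_le K n _ (iota 0 e) (fun=> p) (fun=> d) (fun=> pd).
by rewrite !big_const_seq !count_predT size_iota iter_addn_0 mulnC -Monoid.iteropE.
Qed.

Lemma card_bmultinom_le (m b : nat) : (#|{: 'X_{1..m < b}}| <= b ^ m)%N.
Proof.
case: b => [|b]; first by rewrite eq_card0 // => -[].
pose f (x : 'X_{1..m < b.+1}) : {ffun 'I_m -> 'I_b.+1} := [ffun i => inord (x i)].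
have := @leq_card _ _ f; rewrite card_ffun !card_ord; apply.
move=> x y /ffunP E; apply/val_inj/mnmP => i.
have bd (z : 'X_{1..m < b.+1}) : (z i < b.+1)%N.
  by apply: leq_ltn_trans (bmdeg z); rewrite mdegE (bigD1 i) //= leq_addr.
by have := congr1 val (E i); rewrite !ffunE /= !inordK.
Qed.

Lemma exists_left_null (K : fieldType) (a b : nat) (A : 'M[K]_(a, b)) :
  (b < a)%N -> exists2 v : 'rV_a, v != 0 & v *m A = 0.
Proof.
move=> ba; have : kermx A != 0.
  rewrite kermx_eq0 /row_free neq_ltn (leq_ltn_trans (rank_leq_col A) ba) //.
by case/rowV0Pn => v /sub_kermxP vA v0; exists v.
Qed.

(* More rational functions [phi i / delta] than variables are algebraically   *)
(* dependent: the products [\prod_i (delta ^+ (e - a i) * phi i ^+ a i)] with *)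
(* all exponents at most [e] outnumber, for large [e], the monomials they     *)
(* involve.                                                                   *)
Lemma algebraic_dependence (K : fieldType) (m D : nat)
    (delta : {mpoly K[m]}) (phi : 'I_D -> {mpoly K[m]}) : (m < D)%N ->
  exists2 P : {mpoly K[D]}, P != 0 &
    forall (v : 'I_m -> K) (f : 'I_D -> K), delta.@[v] != 0 ->
      (forall i, delta.@[v] * f i = (phi i).@[v]) -> P.@[f] = 0.
Proof.
move=> mD.
have [M M0 [dM pM]] : exists2 M : nat, (0 < M)%N &
    (msize delta <= M.+1)%N /\ forall i, (msize (phi i) <= M.+1)%N.
  exists (\max_i msize (phi i) + msize delta).+1 => //; split => [|i].
    by rewrite 2?leqW ?leq_addl.
  by rewrite 2?leqW //; apply: leq_trans (leq_bigmax i) (leq_addr _ _).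
(* This [e] gives [b <= (e + 1) (C + 1)], hence [b ^ m <= (e + 1) ^ m * e < (e + 1) ^ D]: fewer
   monomials than products. *)
pose C := (D * M)%N; pose e := (C.+1 ^ m)%N.
pose E := {ffun 'I_D -> 'I_e.+1}.
pose psi (a : E) := \prod_i (delta ^+ (e - a i) * phi i ^+ a i).
pose b := (D * (e * M)).+1.
have size_psi a : (msize (psi a) <= b)%N.
  have := @msize_prod_le K m _ (index_enum 'I_D)
    (fun i => delta ^+ (e - a i) * phi i ^+ a i) (fun=> e * M)%N.
  rewrite sum_nat_const card_ord; apply => i.
  have -> : (e * M = (e - a i) * M + a i * M)%N by rewrite -mulnDl subnK // -ltnS.
  by apply: msize_mul_le; apply: msize_exp_le.
pose A := \matrix_(i < #|{: E}|, j < #|{: 'X_{1..m < b}}|)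
  (psi (enum_val i))@_(enum_val j).
have card_lt : (#|{: 'X_{1..m < b}}| < #|{: E}|)%N.
  apply: leq_ltn_trans (card_bmultinom_le _ _) _.
  rewrite card_ffun !card_ord.
  have bC : (b <= e.+1 * C.+1)%N.
    by rewrite /b mulnCA -/C ltn_mul.
  have leX x y : (x <= y -> x ^ m <= y ^ m)%N.
    by case: (m) => // m' ?; rewrite leq_exp2r.
  apply: leq_ltn_trans (leX _ _ bC) _; rewrite expnMn.
  apply: (@leq_trans (e.+1 ^ m.+1)); last by rewrite leq_pexp2l.
  by rewrite expnSr ltn_pmul2l // expn_gt0.
have [w w0 wA] := exists_left_null A card_lt.
pose mon (a : E) : 'X_{1..D} := [multinom (a i : nat) | i < D].
have mon_inj : injective mon.
  move=> a a' /mnmP aa'; apply/ffunP => i; apply/val_inj.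
  by have := aa' i; rewrite !mnmE.
exists (\sum_i w 0 i *: 'X_[mon (enum_val i)]).
  case/rV0Pn: w0 => i0; apply: contra_neq => /(congr1 (mcoeff (mon (enum_val i0)))).
  rewrite raddf_sum (bigD1 i0) //= mcoeffZ mcoeffX eqxx mulr1 big1 ?addr0 ?mcoeff0 //.
  move=> i ii0; rewrite mcoeffZ mcoeffX inj_eq // (inj_eq enum_val_inj).
  by rewrite (negPf ii0) mulr0.
(* Multiplying by [delta ^ (D * e)] clears denominators: each of the [D] variables absorbs
   [delta ^ e]. *)
move=> v f d0 fE; apply: (mulfI (expf_neq0 (D * e) d0)).
have : \sum_i w 0 i *: psi (enum_val i) = 0.
  apply/mpolyP => x; rewrite mcoeff0 raddf_sum /=.
  have [xb|xb] := ltnP (mdeg x) b.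
    have := congr1 (fun B : 'rV_ _ => B 0 (enum_rank (BMultinom xb))) wA.
    rewrite !mxE => wx; rewrite -[RHS]wx; apply: eq_bigr => i _.
    by rewrite mcoeffZ !mxE enum_rankK.
  apply: big1 => i _; rewrite mcoeffZ memN_msupp_eq0 ?mulr0 //.
  by apply: msize_mdeg_ge; apply: leq_trans (size_psi _) xb.
move=> /(congr1 (meval v)); rewrite mulr0 meval0 => <-.
rewrite !raddf_sum /= mulr_sumr; apply: eq_bigr => i _.
rewrite !mevalZ mulrCA; congr (_ * _).
rewrite mevalX rmorph_prod exprM -{1}(card_ord D) -prodr_const -prodrXl -big_split.
apply: eq_bigr => j _ /=.
rewrite mnmE rmorphM !rmorphXn /= -fE exprMn mulrA -exprD subnK //.
by rewrite -ltnS.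
Qed.


(* Cramer's rule expresses the coefficients of the monomials [mon s] by the   *)
(* [m < #|S|] parameters [t] and the other coefficients of [F].               *)
Lemma elimination (K : fieldType) (N d m : nat) (S : finType)
    (q : S -> 'I_N -> {mpoly K[m]}) (mon : S -> 'X_{1..N}) :
  (m < #|S|)%N -> (forall s, mdeg (mon s) <= d)%N ->
  exists2 P : {mpoly K[#|{: 'X_{1..N < d.+1}}|]}, P != 0 &
    forall (F : {mpoly K[N]}) (t : 'I_m -> K), (msize F <= d.+1)%N ->
      let pt s x := (q s x).@[t] in
      (forall s, F.@[pt s] = 0) ->
      (forall c : S -> K, (forall s, \sum_s' c s' * 'X_[mon s'].@[pt s] = 0) ->
        forall s, c s = 0) ->
      P.@[coefs d F] = 0.
Proof.
move=> mS mon_d.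
have mon_lt s : (mdeg (mon s) < d.+1)%N by rewrite ltnS.
pose idx s : 'I_#|{: 'X_{1..N < d.+1}}| := enum_rank (BMultinom (mon_lt s)).
have [/injectiveP idx_inj|] := boolP (injectiveb idx); last first.
  (* A repeated monomial gives a nonzero kernel vector, contradicting independence, so [P = 1] works
     vacuously. *)
  move=> /injectivePn[s [s' ss' idxE]].
  exists 1; first exact: oner_neq0.
  move=> F t _ pt _ ker.
  have monE : mon s = mon s' by have [] := enum_rank_inj idxE.
  suff /ker/(_ s)/eqP : forall u,
      \sum_s0 ((s0 == s)%:R - (s0 == s')%:R) * 'X_[mon s0].@[pt u] = 0.
    by rewrite eqxx (negPf ss') subr0 oner_eq0.
  move=> u; under eq_bigr do rewrite mulrBl !mulr_natl !mulrb.
  by rewrite sumrB -!big_mkcond !big_pred1_eq monE subrr.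
set D := #|_| in idx idx_inj *.
(* The variables are the coefficients not solved for and the [m] parameters: [D - #|S| + m < D] in
   all. *)
pose T := ({i : 'I_D | i \notin codom idx} + 'I_m)%type.
have card_T : (#|{: T}| < D)%N.
  rewrite card_sum card_ord card_sig -[D in (_ < D)%N]card_ord.
  by rewrite -(cardC (mem (codom idx))) card_codom // addnC ltn_add2r.
pose emb p : {mpoly K[#|{: T}|]} :=
  p \mPo [tuple 'X_(enum_rank (inr j : T)) | j < m].
pose A s (x : 'X_{1..N}) : {mpoly K[m]} := \prod_i q s i ^+ x i.
pose B := \matrix_(a < #|S|, b < #|S|) A (enum_val a) (mon (enum_val b)).
pose cf (u : {i : 'I_D | i \notin codom idx}) a :=
  \sum_b (\adj B) a b * A (enum_val b) (val (enum_val (val u))).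
pose delta := emb (\det B).
(* Numerators over [delta]: Cramer's formula for the coefficient of some [mon s], the variable
   itself for any other. The default [0] is never reached. *)
pose phi i := match [pick s | idx s == i] with
  | Some s => - \sum_u emb (cf u (enum_rank s)) * 'X_(enum_rank (inl u : T))
  | None => delta * oapp (fun u => 'X_(enum_rank (inl u : T))) 0 (insub i)
  end.
have [P P0 PE] := algebraic_dependence delta phi card_T; exists P => //.
move=> F t Fd pt F0 ker; set f := coefs d F.
pose v (a : 'I_#|{: T}|) :=
  match enum_val a with inl u => f (val u) | inr j => t j end.
have embE p : (emb p).@[v] = p.@[t].
  rewrite comp_mpoly_meval; apply: meval_eq => j.
  by rewrite tnth_mktuple mevalXU /v enum_rankK.
pose Bt := map_mx (meval t) B.
have BtE a b : Bt a b = 'X_[mon (enum_val b)].@[pt (enum_val a)].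
  rewrite !mxE mevalX rmorph_prod; apply: eq_bigr => i _.
  by rewrite rmorphXn.
have deltaE : delta.@[v] = \det Bt by rewrite embE det_map_mx.
apply: (PE v) => [|i].
  rewrite deltaE -det_tr; apply/det0P => -[w w0 wB].
  case/rV0Pn: w0 => a /eqP []; rewrite -(enum_valK a).
  apply: (ker (fun s => w 0 (enum_rank s))) => s.
  have := congr1 (fun M : 'rV_ _ => M 0 (enum_rank s)) wB.
  rewrite mxE [RHS]mxE => wBs; rewrite -[RHS]wBs.
  rewrite (reindex _ (onW_bij _ (@enum_val_bij S))) /=; apply: eq_bigr => b _.
  by rewrite enum_valK [RHS]mulrC mxE BtE enum_rankK mulrC.
rewrite deltaE /phi; case: pickP => [s /eqP <-|noS]; last first.
  have iN : i \notin codom idx.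
    by apply/codomP => -[s si]; have := noS s; rewrite si eqxx.
  by rewrite insubT mevalM mevalXU /v enum_rankK deltaE.
pose fS : 'cV_#|S| := \col_b f (idx (enum_val b)).
pose rest : 'cV_#|S| := \col_b \sum_(u : {i : 'I_D | i \notin codom idx})
  (A (enum_val b) (val (enum_val (val u)))).@[t] * f (val u).
(* The conditions [F (pt s) = 0], with the unknown coefficients separated from the others. *)
have fSE : Bt *m fS = - rest.
  apply/eqP; rewrite -addr_eq0; apply/eqP/matrixP => a j; rewrite !mxE.
  rewrite -[RHS](F0 (enum_val a)) (mpolywE Fd) raddf_sum /=.
  rewrite (reindex (enum_val : 'I_D -> 'X_{1..N < d.+1})) /=; last first.
    exact: (onW_bij _ (@enum_val_bij _)).
  rewrite (bigID (mem (codom idx))) /=; congr (_ + _).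
    have uq : uniq (codom idx) by rewrite map_inj_uniq ?enum_uniq.
    rewrite -(big_uniq _ uq) big_image /=.
    rewrite (reindex _ (onW_bij _ (@enum_val_bij S))) /=; apply: eq_bigr => b _.
    by rewrite BtE !mxE mevalZ mulrC /f /coefs enum_rankK.
  rewrite [RHS](reindex_omap (val : {i : 'I_D | i \notin codom idx} -> 'I_D) insub).
    apply: eq_big => [[u uN]|u _] /=; first by rewrite uN insubT /= eqxx.
    rewrite mevalZ mevalX mulrC rmorph_prod; congr (_ * _).
    by apply: eq_bigr => x _; rewrite rmorphXn.
  by move=> u uN; rewrite insubT.
have /(congr1 (mulmx (\adj Bt))) := fSE.
rewrite mulmxA mul_adj_mx mul_scalar_mx => /matrixP/(_ (enum_rank s) 0).
rewrite mxE [fS _ _]mxE [RHS]mxE enum_rankK => ->.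
rewrite mevalN (raddf_sum (meval v)) -sumrN.
under eq_bigr do rewrite [(- rest) _ _]mxE [rest _ _]mxE mulrN mulr_sumr.
rewrite !sumrN exchange_big /= -!sumrN; apply: eq_bigr => u _.
rewrite mevalM mevalXU embE /v enum_rankK (raddf_sum (meval t)) mulr_suml.
congr (- _); apply: eq_bigr => b _.
by rewrite -map_mx_adj mxE mulrA /= mevalM.
Qed.


(** * Meeting hypersurfaces with lines, and shears *)

Lemma horner_mmap (R : comNzRingType) (n : nat) (c : 'I_n -> {poly R})
    (p : {mpoly R[n]}) (z : R) :
  (mmap (@polyC R) c p).[z] = p.@[fun i => (c i).[z]].
Proof.
rewrite mevalE /mmap horner_sum; apply: eq_bigr => m _.
rewrite hornerM hornerC /mmap1 horner_prod; congr (_ * _).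
by apply: eq_bigr => i _; rewrite horner_exp.
Qed.

Lemma mpoly_ext (K : numFieldType) (n : nat) (p q : {mpoly K[n]}) :
  (forall v, p.@[v] = q.@[v]) -> p = q.
Proof.
move=> pq; apply/eqP; rewrite -subr_eq0; apply: contraT => /mpoly_non_root[v].
by rewrite mevalB pq subrr eqxx.
Qed.

(* A non-constant [G] has a zero on almost every line of the pencil of lines  *)
(* through [b] with direction [w + z v] for suitable [v]: if it had none,     *)
(* [G] would be constant on the line, so [G (b + w + z v) = G b].             *)
Lemma zero_on_lines (K : numClosedFieldType) (n : nat) (G : {mpoly K[n]})
    (I : finType) (b : I -> 'I_n -> K) (w : 'I_n -> K) :
  (forall c, G <> c%:MP) ->
  exists v : 'I_n -> K, exists2 h : {poly K}, h != 0 &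
    forall z, h.[z] != 0 -> forall e, exists t : K,
      G.@[fun i => b e i + t * (w i + z * v i)] = 0.
Proof.
move=> Gnc.
pose Q e := (G \mPo [tuple 'X_i + (b e i + w i)%:MP | i < n]) - (G.@[b e])%:MP.
have QE e v : (Q e).@[v] = G.@[fun i => b e i + (w i + v i)] - G.@[b e].
  rewrite mevalB mevalC comp_mpoly_meval; congr (_ - _); apply: meval_eq => i.
  by rewrite tnth_mktuple mevalD mevalXU mevalC addrC addrA.
(* If some [Q e] were zero, [G] would be constant, since [b e + w + v] ranges over the whole
   space. *)
have : \prod_e Q e != 0.
  rewrite prodf_seq_neq0; apply/allP => e _; apply/implyP => _.
  apply/eqP => Qe0; apply: (Gnc G.@[b e]); apply: mpoly_ext => v.
  have := QE e (fun i => v i - b e i - w i); rewrite Qe0 meval0 mevalC => /esym/eqP.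
  rewrite subr_eq0 => /eqP <-; apply: meval_eq => i.
  by rewrite [w i + _]addrC subrK addrC subrK.
move=> /mpoly_non_root[v]; rewrite rmorph_prod /= => Qv.
pose h e := mmap (@polyC K) (fun i => (b e i + w i)%:P + v i *: 'X) G - (G.@[b e])%:P.
have hE e z : (h e).[z] = G.@[fun i => b e i + (w i + z * v i)] - G.@[b e].
  rewrite !hornerE horner_mmap; congr (_ - _); apply: meval_eq => i.
  by rewrite !hornerE /=; ring.
exists v; exists (\prod_e h e) => [|z hz e].
  apply: contraNneq Qv => h0; have := congr1 (fun p => p.[1]) h0.
  rewrite horner_prod horner0 => /eqP; rewrite !prodf_seq_eq0.
  apply: sub_has => e /=; rewrite hE QE; congr (_ == 0); congr (_ - _).
  by apply: meval_eq => i; rewrite mul1r.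
have he : (h e).[z] != 0.
  apply: contraNneq hz => he; rewrite horner_prod (bigD1 e) //= he mul0r //.
pose g := mmap (@polyC K) (fun i => (b e i)%:P + (w i + z * v i) *: 'X) G.
have gE t : g.[t] = G.@[fun i => b e i + t * (w i + z * v i)].
  by rewrite horner_mmap; apply: meval_eq => i; rewrite !hornerE [t * _]mulrC.
(* A restriction [g] without roots is constant, so [g.[1] = g.[0]], which says [(h e).[z] = 0]. *)
have /closed_rootP[t /rootP] : size g != 1.
  apply: contraNneq he => /eqP/size_poly1P[c _ gc]; rewrite hE subr_eq0.
  have <- : g.[1] = G.@[fun i => b e i + (w i + z * v i)].
    by rewrite gE; apply: meval_eq => i; rewrite mul1r.
  have <- : g.[0] = G.@[b e].
    by rewrite gE; apply: meval_eq => i; rewrite mul0r addr0.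
  by rewrite gc !hornerC.
by rewrite gE; exists t.
Qed.

(* The coefficients of [F (x_i + z (v i) x_(r i))] as polynomials in [z]. *)
Definition shear (K : fieldType) (N : nat) (r : 'I_N -> 'I_N) (v : 'I_N -> K)
    (F : {mpoly K[N]}) : {mpoly {poly K}[N]} :=
  \sum_(m <- msupp F) (F@_m)%:P *:
    \prod_i ('X_i + (v i *: 'X) *: 'X_(r i)) ^+ m i.

Lemma msize_shear (K : fieldType) (N : nat) (r : 'I_N -> 'I_N) (v : 'I_N -> K)
    (F : {mpoly K[N]}) (d : nat) :
  (msize F <= d.+1 -> msize (shear r v F) <= d.+1)%N.
Proof.
move=> Fd; apply: leq_trans (msize_sum _ _ _) _.
apply/bigmax_leqP_seq => m mF _; apply: leq_trans (msizeZ_le _ _) _.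
apply: leq_trans (leq_trans (msize_mdeg_lt mF) Fd); rewrite mdegE.
apply: msize_prod_le => i; rewrite -[X in (_ <= X.+1)%N]muln1.
apply: msize_exp_le; apply: leq_trans (msizeD_le _ _) _.
rewrite geq_max msizeX mdeg1 leqnn.
by apply: leq_trans (msizeZ_le _ _) _; rewrite msizeX mdeg1.
Qed.

Lemma meval_shear (K : fieldType) (N : nat) (r : 'I_N -> 'I_N) (v : 'I_N -> K)
    (F : {mpoly K[N]}) (z : K) (p : 'I_N -> K) :
  (map_mpoly (horner_eval z) (shear r v F)).@[p] =
  F.@[fun i => p i + z * v i * p (r i)].
Proof.
rewrite (raddf_sum (map_mpoly (horner_eval z))) (raddf_sum (meval p)) mevalE /=.
apply: eq_bigr => m _.
rewrite map_mpolyZ mevalZ /= /horner_eval hornerC; congr (_ * _).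
rewrite (rmorph_prod (map_mpoly (horner_eval z))) (rmorph_prod (meval p)).
apply: eq_bigr => i _; rewrite !rmorphXn /=.
rewrite rmorphD /= map_mpolyZ !map_mpolyX mevalD mevalZ !mevalXU.
by rewrite /= /horner_eval !hornerE [v i * _]mulrC.
Qed.

(** * Grids of points and the reduction to a relation *)

(** The point of the factor [j] on its line [e j] has unknown coordinate 0. The ring [R] is general
    so that the unknowns can be both values and polynomials in parameters. *)
Definition grid_point (R : nzSemiRingType) (k : nat) (n : 'I_k -> nat)
    (t : 'I_k -> 'I_3 -> R) (e : 'I_k -> 'I_3) (x : 'I_(\sum_(j < k) n j)) : R :=
  let: existT j i := tagnat.sig x in
  match val i with 0%N => t j (e j) | 1%N => (e j)%:R | _ => 0 end.

Lemma grid_point_Rank (R : nzSemiRingType) (k : nat) (n : 'I_k -> nat)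
    (t : 'I_k -> 'I_3 -> R) (e : 'I_k -> 'I_3) (j : 'I_k) (i : 'I_(n j)) :
  grid_point t e (tagnat.Rank j i) =
  match val i with 0%N => t j (e j) | 1%N => (e j)%:R | _ => 0 end.
Proof. by rewrite /grid_point /tagnat.Rank tagnat.rankK. Qed.

(* The lines along the coordinates 0 may miss the hypersurfaces [G j = 0]; a  *)
(* shear depending on [z] repairs this for almost all [z], while              *)
(* [P.@[coefs d _]] of the sheared polynomial is polynomial in [z].           *)
Lemma generic_non_cartesian (K : numClosedFieldType) (k : nat) (n : 'I_k -> nat)
    (d : nat) (P : {mpoly K[#|{: 'X_{1..(\sum_(j < k) n j) < d.+1}}|]}) :
  (forall j, 2 <= n j)%N -> P != 0 ->
  (forall (F : {mpoly K[\sum_(j < k) n j]}) (t : 'I_k -> 'I_3 -> K),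
    (msize F <= d.+1)%N -> (forall e, F.@[grid_point t e] = 0) ->
    P.@[coefs d F] = 0) ->
  generic d (fun F : {mpoly K[\sum_(j < k) n j]} => ~ cartesian F).
Proof.
move=> n2 P0 PF.
exists (fun F => (msize F <= d.+1)%N /\ P.@[coefs d F] <> 0); split.
- exists (eq P) => F; split=> [[Fd PF0]|[Fd [Q <- PF0]]]; last by [].
  by split=> //; exists P.
- have [f Pf] := mpoly_non_root P0.
  exists (\sum_i f i *: 'X_[enum_val i]); split.
    apply: leq_trans (msize_sum _ _ _) _; apply/bigmax_leqP_seq => i _ _.
    by apply: leq_trans (msizeZ_le _ _) _; rewrite msizeX bmdeg.
  apply/eqP; apply: contraNneq Pf => <-; apply/eqP/meval_eq => i.
  rewrite /coefs raddf_sum (bigD1 i) //= mcoeffZ mcoeffX eqxx mulr1.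
  rewrite big1 ?addr0 // => j ji; rewrite mcoeffZ mcoeffX.
  by rewrite val_eqE (inj_eq enum_val_inj) (negPf ji) mulr0.
move=> F [Fd PF0] [G [H [Gnc FE]]].
apply: PF0; pose i0 j : 'I_(n j) := Ordinal (ltnW (n2 j)).
pose b j (e : 'I_3) (i : 'I_(n j)) : K := if val i is 1%N then e%:R else 0.
have [v /fin_all_exists2[h h0 hz]] := fin_all_exists (fun j =>
  zero_on_lines (b j) (fun i => (i == i0 j)%:R) (Gnc j)).
(* The shear adds multiples of coordinate 0 of the same factor, so it maps the grid lines to the
   lines of [zero_on_lines]. *)
pose r (x : 'I_(\sum_(j < k) n j)) := let: existT j _ := tagnat.sig x in tagnat.Rank j (i0 j).
pose w x := let: existT j i := tagnat.sig x in v j i.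
pose Fs z := map_mpoly (horner_eval z) (shear r w F).
have FsE z p : (Fs z).@[p] = F.@[fun i => p i + z * w i * p (r i)].
  exact: meval_shear.
pose Q := mmap (@polyC K)
  (fun i => (shear r w F)@_(enum_val i : 'X_{1..(\sum_(j < k) n j) < d.+1})) P.
have QE z : Q.[z] = P.@[coefs d (Fs z)].
  by rewrite horner_mmap; apply: meval_eq => i; rewrite /coefs mcoeff_map_mpoly.
(* Either some [h j] vanishes at [z], or all the lines meet their hypersurfaces and the sheared [F]
   vanishes on a grid. *)
have Qh0 z : (Q * \prod_j h j).[z] = 0.
  rewrite hornerM; have [|hz0] := eqVneq (\prod_j h j).[z] 0.
    by move=> ->; rewrite mulr0.
  have {}hz j e : exists t, (G j).@[fun i => b j e i + t * ((i == i0 j)%:R + z * v j i)] = 0.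
    apply: hz; apply: contraNneq hz0 => hz0.
    by rewrite horner_prod (bigD1 j) //= hz0 mul0r.
  have [t tG] := fin_all_exists (fun j => fin_all_exists (hz j)).
  rewrite QE (PF _ t) ?mul0r // => [|e].
    apply: leq_trans (msize_shear r w Fd).
    rewrite msizeE; apply/bigmax_leqP_seq => m mF _; apply: msize_mdeg_lt.
    apply: contraTT mF => /memN_msupp_eq0 mF.
    by rewrite mcoeff_msupp negbK mcoeff_map_mpoly mF /= /horner_eval horner0.
  rewrite FsE FE raddf_sum big1 // => j _; rewrite /= mevalM.
  rewrite [X in X * _](_ : _ = 0) ?mul0r // /embed_factor comp_mpoly_meval.
  rewrite -[RHS](tG j (e j)); apply: meval_eq => i.
  rewrite tnth_mktuple mevalXU /r /w /tagnat.Rank tagnat.rankK.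
  rewrite !grid_point_Rank /= /b -val_eqE /=.
  by case: (val i) => [|[|a]] /=; ring.
have Q0 : Q = 0.
  apply/eqP; have : Q * \prod_j h j == 0.
    by apply: contraT => /poly_non_root[z]; rewrite Qh0 eqxx.
  rewrite mulf_eq0 => /orP[//|]; rewrite prodf_seq_eq0 => /hasP[j _ /= /eqP hj].
  by have := h0 j; rewrite hj eqxx.
(* At [z = 0] the shear is the identity. *)
have := QE 0; rewrite Q0 horner0 => /esym <-; congr (P.@[coefs d _]).
apply: mpoly_ext => p; rewrite FsE; apply: meval_eq => x.
by rewrite mul0r mul0r addr0.
Qed.


(** The polynomials [tau] let the unknown coordinates depend on fewer parameters, as they do for
    collinear points. *)
Lemma grid_elimination (K : fieldType) (k : nat) (n : 'I_k -> nat) (d : nat)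
    (S T : finType) (tau : 'I_k -> 'I_3 -> {mpoly K[#|{: T}|]})
    (e : S -> 'I_k -> 'I_3) (mon : S -> 'X_{1..(\sum_(j < k) n j)}) :
  (#|{: T}| < #|S|)%N -> (forall s, mdeg (mon s) <= d)%N ->
  exists2 P : {mpoly K[#|{: 'X_{1..(\sum_(j < k) n j) < d.+1}}|]}, P != 0 &
    forall (F : {mpoly K[\sum_(j < k) n j]}) (t : 'I_k -> 'I_3 -> K) (u : T -> K),
      (msize F <= d.+1)%N ->
      (forall s j, (tau j (e s j)).@[fun a => u (enum_val a)] = t j (e s j)) ->
      (forall e, F.@[grid_point t e] = 0) ->
      (forall c : S -> K,
        (forall s, \sum_s' c s' * 'X_[mon s'].@[grid_point t (e s)] = 0) ->
        forall s, c s = 0) ->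
      P.@[coefs d F] = 0.
Proof.
move=> TS mond.
have [P P0 PE] := elimination (fun s => grid_point tau (e s)) TS mond.
exists P => // F t u Fd tauE F0 ker.
have ptE s : (fun x => (@grid_point _ k n tau (e s) x).@[fun a => u (enum_val a)])
    =1 grid_point t (e s).
  move=> x; rewrite /grid_point; case: (tagnat.sig x) => j i.
  by case: (val i) => [|[|a]]; rewrite ?tauE ?meval0 // rmorph_nat.
apply: (PE F (fun a => u (enum_val a)) Fd) => [s|c c0].
  by rewrite (meval_eq _ (ptE s)) F0.
apply: ker => s; rewrite -[RHS](c0 s); apply: eq_bigr => s' _.
by rewrite (meval_eq _ (ptE s)).
Qed.

(** * Three or more factors *)

Definition bit (b : bool) : 'I_3 := if b then lift ord0 ord0 else ord0.

Lemma natr_bit (R : nzSemiRingType) (b : bool) : (bit b)%:R = b%:R :> R.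
Proof. by case: b. Qed.

(* [y_j] being the coordinate 1 of the factor [j], the [2 k + 1] monomials    *)
(* [1], [y_j], [y_j y_(j+1)] are independent on the points of the grid above  *)
(* [0], [e_j], [e_j + e_(j+1)] of [{0,1} ^ k], which have [2 k] parameters.   *)
Lemma generic_non_cartesian_ge3 (K : numClosedFieldType) (k : nat)
    (n : 'I_k -> nat) (d : nat) :
  (forall j, 2 <= n j)%N -> (2 <= d)%N -> (3 <= k)%N ->
  generic d (fun F : {mpoly K[\sum_(j < k) n j]} => ~ cartesian F).
Proof.
move=> n2 d2 k3; pose y j := tagnat.Rank j (Ordinal (n2 j)).
(* For [k >= 3], [j] and its first two cyclic successors are distinct, so the pairs of neighbours
   are distinct too. *)
have S1 (j : 'I_k) : ordS j != j.
  rewrite -val_eqE /=; case: j => j /= jk.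
  have [ltk|kj] := ltnP j.+1 k; first by rewrite modn_small //; lia.
  have -> : j.+1 = k by lia.
  by rewrite modnn; lia.
have S2 (j : 'I_k) : ordS (ordS j) != j.
  rewrite -val_eqE /= -addn1 modnDml addn1; case: j => j /= jk.
  have [ltk|kj] := ltnP j.+2 k; first by rewrite modn_small //; lia.
  have -> : (j.+2 = (j.+2 - k) + k)%N by lia.
  by rewrite modnDr modn_small; lia.
pose T := ('I_k * bool)%type; pose S := option ('I_k + 'I_k).
pose b (s : S) l := match s with
  | None => false | Some (inl j) => l == j | Some (inr j) => (l == j) || (l == ordS j) end.
pose mon (s : S) := match s with
  | None => 0 | Some (inl j) => U_(y j) | Some (inr j) => U_(y j) + U_(y (ordS j)) end%MM.
pose tau j (e : 'I_3) : {mpoly K[#|{: T}|]} := 'X_(enum_rank (j, e != ord0)).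
have TS : (#|{: T}| < #|{: S}|)%N.
  by rewrite card_prod card_bool card_option card_sum !card_ord muln2 addnn.
have mond s : (mdeg (mon s) <= d)%N.
  by case: s => [[j|j]|]; rewrite /= ?mdegD ?mdeg1 ?mdeg0 //; exact: ltnW.
have [P P0 PF] := grid_elimination tau (fun s l => bit (b s l)) TS mond.
apply: (generic_non_cartesian n2 P0) => F t Fd F0.
apply: (PF F t (fun a => t a.1 (bit a.2)) Fd) => // [s j|c c0].
  by rewrite mevalXU enum_rankK /=; case: (b s j).
have grid_y e j : grid_point t e (y j) = (e j)%:R by rewrite grid_point_Rank.
have monE s s' : 'X_[mon s'].@[grid_point t (fun l => bit (b s l))] =
    match s' with None => true | Some (inl j) => b s j
    | Some (inr j) => b s j && b s (ordS j) end%:R.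
  case: s' => [[j|j]|] /=; first by rewrite mevalXU grid_y natr_bit.
    by rewrite mpolyXD mevalM !mevalXU !grid_y !natr_bit -natrM mulnb.
  by rewrite mpolyX0 meval1.
(* Triangularity: each monomial is 1 at its own point, so the coefficients die in the order [1],
   [y_j], [y_j y_(j+1)]. *)
have step s : (forall s', s' != s -> c s' = 0 \/
    'X_[mon s'].@[grid_point t (fun l => bit (b s l))] = 0) -> c s = 0.
  move=> cs; have := c0 s; rewrite (bigD1 s) //= [X in _ + X = _]big1 => [|s' /cs[] ->].
  + rewrite addr0 monE; case: (s) => [[j|j]|] /=; rewrite ?eqxx ?orbT mulr1 //.
  + by rewrite mul0r.
  + by rewrite mulr0.
have cN : c None = 0.
  by apply: step => -[[j|j]|] // _; right; rewrite monE.
have cl j : c (Some (inl j)) = 0.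
  apply: step => -[[i|i]|] ij; [right|right|by left]; rewrite monE /=.
    by case: (i =P j) ij => // ->; case/eqP.
  by case: (i =P j) => // ->; rewrite (negPf (S1 j)).
have cr j : c (Some (inr j)) = 0.
  apply: step => -[[i|i]|] ij; [by left|right|by left]; rewrite monE /=.
  case: (i =P j) ij => [->|_ _]; first by case/eqP.
  by case: (i =P ordS j) => //= ->; rewrite (negPf (S2 j)) (negPf (S1 _)).
by case=> [[j|j]|].
Qed.

(** * Two factors *)

Definition pair_point (a : 'I_3) (b : bool) (j : 'I_2) : 'I_3 :=
  if j == ord0 then a else bit b.

Lemma ord3P (a : 'I_3) :
  [\/ a = ord0, a = bit true | a = lift ord0 (lift ord0 ord0)].
Proof.
by case: a => -[|[|[|//]]] ?; [constructor 1|constructor 2|constructor 3]; apply: val_inj.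
Qed.

Lemma ord2P (j : 'I_2) : j = ord0 \/ j = lift ord0 ord0.
Proof. by case: j => -[|[|//]] ?; [left|right]; apply: val_inj. Qed.

(* [x_j] and [y_j] being the coordinates 0 and 1 of the factor [j], the       *)
(* monomials [1], [y_0], [x_0] times [1], [y_1] are independent on the six    *)
(* pairs, for 5 parameters, if the three points of the first hypersurface are *)
(* not collinear.                                                             *)
Lemma noncollinear_elimination (K : numClosedFieldType) (n : 'I_2 -> nat) (d : nat) :
  (forall j, 2 <= n j)%N -> (2 <= d)%N ->
  exists2 P : {mpoly K[#|{: 'X_{1..(\sum_(j < 2) n j) < d.+1}}|]}, P != 0 &
    forall (F : {mpoly K[\sum_(j < 2) n j]}) (t : 'I_2 -> 'I_3 -> K),
      (msize F <= d.+1)%N ->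
      t ord0 (lift ord0 (lift ord0 ord0)) != t ord0 (bit true) *+ 2 - t ord0 ord0 ->
      (forall e, F.@[grid_point t e] = 0) -> P.@[coefs d F] = 0.
Proof.
move=> n2 d2; pose j0 : 'I_2 := ord0; pose j1 : 'I_2 := lift ord0 ord0.
pose i2 : 'I_3 := lift ord0 (lift ord0 ord0).
have v1 : bit true = 1%N :> nat by [].
have v2 : i2 = 2 :> nat by [].
pose x j := tagnat.Rank j (Ordinal (ltnW (n2 j))).
pose y j := tagnat.Rank j (Ordinal (n2 j)).
have grid_x (t : 'I_2 -> 'I_3 -> K) e j : grid_point t e (x j) = t j (e j).
  by rewrite grid_point_Rank.
have grid_y (t : 'I_2 -> 'I_3 -> K) e j : grid_point t e (y j) = (e j)%:R.
  by rewrite grid_point_Rank.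
pose S := ('I_3 * bool)%type; pose T := ('I_3 + bool)%type.
pose mon (s : S) := ((if s.1 == ord0 then 0 else if s.1 == i2 then U_(x j0)
  else U_(y j0)) + (if s.2 then U_(y j1) else 0))%MM.
pose tau (j : 'I_2) a : {mpoly K[#|{: T}|]} :=
  'X_(enum_rank (if j == j0 then inl a else inr (a != ord0) : T)).
have TS : (#|{: T}| < #|{: S}|)%N by rewrite card_prod card_sum card_bool !card_ord.
have mond s : (mdeg (mon s) <= d)%N.
  apply: leq_trans d2; rewrite mdegD; apply: (@leq_add _ _ 1 1).
    by case: ifP => _; [rewrite mdeg0|case: ifP => _; rewrite mdeg1].
  by case: ifP; rewrite ?mdeg0 ?mdeg1.
have [P P0 PF] := grid_elimination tau (fun s => pair_point s.1 s.2) TS mond.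
exists P => // F t Fd tN F0.
pose u (s : T) := match s with inl a => t j0 a | inr b => t j1 (bit b) end.
apply: (PF F t u Fd) => //.
  move=> s j; rewrite mevalXU enum_rankK.
  have [->|->] := ord2P j => //=; by case: (s.2).
move=> c c0.
(* The combination is affine in [y_1] with coefficients [M a false] and [M a true]; its zeros at
   [y_1 = 0] and [1] kill both. *)
pose M (a : 'I_3) (b : bool) := c (ord0, b) + c (bit true, b) * a%:R + c (i2, b) * t j0 a.
have E (a : 'I_3) (b : bool) : M a false + M a true * b%:R = 0.
  pose f (a' : 'I_3) := if a' == ord0 then 1 else if a' == i2 then t j0 a else a%:R.
  pose g (b' : bool) : K := if b' then b%:R else 1.
  have := c0 (a, b).
  rewrite (eq_bigr (fun s' => c (s'.1, s'.2) * (f s'.1 * g s'.2))); last first.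
    case=> [a' b'] _; congr (_ * _); rewrite /mon mpolyXD mevalM.
    congr (_ * _); last first.
      by rewrite /g; case: b'; rewrite ?mpolyX0 ?meval1 // mevalXU grid_y natr_bit.
    rewrite /f /=; case: ifP => _; first by rewrite mpolyX0 meval1.
    by case: ifP => _; rewrite mevalXU ?grid_x ?grid_y.
  rewrite -(pair_bigA _ (fun a' b' => c (a', b') * (f a' * g b'))) /=.
  rewrite !big_ord_recl big_ord0 !big_bool => <-.
  have -> : lift ord0 ord0 = bit true by [].
  rewrite -/i2 /M /f /g /=; ring.
have M0 a b : M a b = 0.
  have Ma : M a false = 0 by rewrite -(E a false) mulr0 addr0.
  by case: b => //; rewrite -(E a true) Ma mulr1 add0r.
(* The second difference of [M] in [a] removes the part affine in [y_0]; the factor left is nonzero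
   by noncollinearity. *)
have c2 b : c (i2, b) = 0.
  have : c (i2, b) * (t j0 i2 - (t j0 (bit true) *+ 2 - t j0 ord0)) =
      M i2 b - M (bit true) b *+ 2 + M ord0 b by rewrite /M v1 v2 /=; ring.
  rewrite !M0 mul0rn subrr addr0 => /eqP; rewrite mulf_eq0 subr_eq0 (negPf tN) orbF.
  by move/eqP.
have c0' b : c (ord0, b) = 0.
  by rewrite -(M0 ord0 b) /M c2 /= mulr0 mul0r !addr0.
have c1 b : c (bit true, b) = 0.
  by rewrite -(M0 (bit true) b) /M v1 c2 c0' /= mulr1 mul0r addr0 add0r.
by case=> a b; case: (ord3P a) => ->.
Qed.

(* Collinearity removes one parameter, and [1], [y_0], [y_0 ^ 2], [y_1],      *)
(* [y_0 y_1] are independent on five of the pairs, for 4 parameters.          *)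
Lemma collinear_elimination (K : numClosedFieldType) (n : 'I_2 -> nat) (d : nat) :
  (forall j, 2 <= n j)%N -> (2 <= d)%N ->
  exists2 P : {mpoly K[#|{: 'X_{1..(\sum_(j < 2) n j) < d.+1}}|]}, P != 0 &
    forall (F : {mpoly K[\sum_(j < 2) n j]}) (t : 'I_2 -> 'I_3 -> K),
      (msize F <= d.+1)%N ->
      t ord0 (lift ord0 (lift ord0 ord0)) = t ord0 (bit true) *+ 2 - t ord0 ord0 ->
      (forall e, F.@[grid_point t e] = 0) -> P.@[coefs d F] = 0.
Proof.
move=> n2 d2; pose j0 : 'I_2 := ord0; pose j1 : 'I_2 := lift ord0 ord0.
pose i2 : 'I_3 := lift ord0 (lift ord0 ord0).
have v1 : bit true = 1%N :> nat by [].
have v2 : i2 = 2 :> nat by [].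
pose y j := tagnat.Rank j (Ordinal (n2 j)).
have grid_y (t : 'I_2 -> 'I_3 -> K) e j : grid_point t e (y j) = (e j)%:R.
  by rewrite grid_point_Rank.
pose S := ('I_3 + bool)%type; pose T := (bool + bool)%type.
pose mon (s : S) := match s with
  | inl a => U_(y j0) *+ a | inr b => U_(y j0) *+ b + U_(y j1) end%MM.
pose e (s : S) := match s with inl a => pair_point a false | inr b => pair_point (bit b) true end.
pose X (s : T) : {mpoly K[#|{: T}|]} := 'X_(enum_rank s).
(* Collinearity expresses the third unknown of the first factor through the other two. *)
pose tau (j : 'I_2) a : {mpoly K[#|{: T}|]} :=
  if j == j0 then if a == i2 then X (inl true) *+ 2 - X (inl false)
    else X (inl (a != ord0))
  else X (inr (a != ord0)).
have TS : (#|{: T}| < #|{: S}|)%N by rewrite !card_sum !card_bool !card_ord.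
have mond s : (mdeg (mon s) <= d)%N.
  apply: leq_trans d2; case: s => [a|b]; rewrite /= ?mdegD mdegMn !mdeg1 mul1n.
    by rewrite -ltnS.
  by case: b.
have [P P0 PF] := grid_elimination tau e TS mond.
exists P => // F t Fd tE F0.
pose u (s : T) := match s with inl b => t j0 (bit b) | inr b => t j1 (bit b) end.
apply: (PF F t u Fd) => //.
  have XE s : (X s).@[fun a => u (enum_val a)] = u s.
    by rewrite mevalXU enum_rankK.
  move=> s j; rewrite /tau /e.
  have [->|->] := ord2P j; rewrite /=; last first.
    by case: s => [a|[]]; rewrite XE.
  case: s => [a|b]; rewrite /pair_point /=; last by case: b; rewrite XE.
  by case: (ord3P a) => ->; rewrite /= ?mevalB ?mevalMn !XE // tE.
move=> c c0.
pose L (a : 'I_3) (b : bool) :=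
  c (inl ord0) + c (inl (bit true)) * a%:R + c (inl i2) * a%:R ^+ 2 +
  (c (inr false) + c (inr true) * a%:R) * b%:R.
have E a b : (b ==> (a != i2)) -> L a b = 0.
  move=> ab; have [s sE] : exists s : S, e s = pair_point a b.
    case: b ab => [ab|_]; [exists (inr (a != ord0))|by exists (inl a)].
    by case: (ord3P a) ab => ->.
  have := c0 s; rewrite sE (eq_bigr (fun s' => c s' * match s' with
      inl a' => a%:R ^+ a' | inr b' => a%:R ^+ b' * b%:R end)); last first.
    case=> [a'|b'] _; congr (_ * _); rewrite /mon ?mpolyXD ?mevalM -mpolyXn.
      by rewrite rmorphXn /= mevalXU grid_y.
    by rewrite rmorphXn /= !mevalXU !grid_y natr_bit.
  rewrite big_sumType big_bool !big_ord_recl big_ord0 => <-.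
  have -> : lift ord0 ord0 = bit true by [].
  rewrite -/i2 /L /= /bump /=; ring.
have q0 : c (inl ord0) = 0 by rewrite -(E ord0 false isT) /L /=; ring.
(* A second difference along [y_1 = 0] isolates twice the coefficient of [y_0 ^ 2]. *)
have q2 : c (inl i2) = 0.
  have /eqP : c (inl i2) *+ 2 = L i2 false - L (bit true) false *+ 2 + L ord0 false.
    by rewrite /L v1 v2 /=; ring.
  by rewrite !E // mul0rn subrr addr0 mulrn_eq0 => /eqP.
have q1 : c (inl (bit true)) = 0.
  have : L (bit true) false = 0 by apply: E.
  by rewrite /L ?v1 q0 q2 /= mulr1 mul0r mulr0 !addr0 add0r.
have r0 : c (inr false) = 0.
  have : L ord0 true = 0 by apply: E.
  by rewrite /L ?v1 q0 q1 q2 /= !mul0r mulr0 !mulr1 !addr0 !add0r.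
have r1 : c (inr true) = 0.
  have : L (bit true) true = 0 by apply: E.
  by rewrite /L ?v1 q0 q1 q2 r0 /= !mul0r !mulr1 !add0r.
by case=> [a|[]] //; case: (ord3P a) => ->.
Qed.

(** Whether or not the three points are collinear, one factor of [P1 * P2] vanishes at [F]. *)
Lemma generic_non_cartesian_2 (K : numClosedFieldType) (n : 'I_2 -> nat) (d : nat) :
  (forall j, 2 <= n j)%N -> (2 <= d)%N ->
  generic d (fun F : {mpoly K[\sum_(j < 2) n j]} => ~ cartesian F).
Proof.
move=> n2 d2.
have [P1 P10 PF1] := noncollinear_elimination K n2 d2.
have [P2 P20 PF2] := collinear_elimination K n2 d2.
apply: (generic_non_cartesian n2 (mulf_neq0 P10 P20)) => F t Fd F0.
rewrite mevalM; apply/eqP; rewrite mulf_eq0; apply/orP.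
have [tE|tN] := eqVneq (t ord0 (lift ord0 (lift ord0 ord0)))
  (t ord0 (bit true) *+ 2 - t ord0 ord0); [right|left]; apply/eqP.
  exact: (PF2 F t Fd tE F0).
exact: (PF1 F t Fd tN F0).
Qed.

Theorem theorem4p1 (R : realType) (k : nat) (hk : (2 <= k)%N)
    (n : 'I_k -> nat)
    (n_noninc : forall i j : 'I_k, (i <= j)%N -> (n j <= n i)%N)
    (n_ge2 : forall j : 'I_k, (2 <= n j)%N) :
  ((k <= n (Ordinal (ltnW hk)))%N ->
    forall d : nat, (2 <= d)%N ->
      generic d (fun F : {mpoly R[i][\sum_(j < k) n j]} => ~ cartesian F)) /\
  (forall d : nat, (maxn (2 * k - 3) 7 <= d)%N ->
      generic d (fun F : {mpoly R[i][\sum_(j < k) n j]} => ~ cartesian F)).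
Proof.
(* Both bounds on [d] give [2 <= d]; the cases are [k >= 3] and [k = 2]. *)
have main d : (2 <= d)%N ->
    generic d (fun F : {mpoly R[i][\sum_(j < k) n j]} => ~ cartesian F).
  move=> d2; have [k3|k2] := leqP 3 k.
    exact: generic_non_cartesian_ge3.
  have kE : k = 2%N by lia.
  move: n n_ge2 {hk n_noninc k2}; rewrite kE => n n_ge2.
  exact: generic_non_cartesian_2.
by split=> [_|] d dk; apply: main; lia.
Qed.
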